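(* Let $p>5$ be a prime and $\phi_{\pm}=(1\pm\sqrt{5})/2$. Then \begin{align*} \pounds_2(\phi_{\pm})&\equiv \mp \frac{\sqrt{5}}{10}\left(\frac{p}{5}\right)q_L^2\pmod{p},\\ \pounds_2(\phi^2_{\pm})&\equiv -\frac{1}{2}\left(1\pm \frac{\sqrt{5}}{5}\left(\frac{p}{5}\right)\right)q_L^2 \pmod{p},\\ \pounds_2(-\phi_{\pm})&\equiv -\frac{1}{4}\left(1\pm \frac{\sqrt{5}}{5}\left(\frac{p}{5}\right)\right)q_L^2 \pmod{p},\\ \pounds_3(\phi_{\pm}^2)&\equiv -\frac{2}{15}\left(1\pm\sqrt{5}\left(\frac{p}{5}\right)\right)\left(\frac{1}{2}q_L^3 +B_{p-3}\right) \pmod{p}. \end{align*}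
   Context: For a prime $p$ and a positive integer $d$, the finite polylogarithm is $\pounds_d(x)=\sum_{k=1}^{p-1} x^k/k^d$. $L_n$ is the $n$-th Lucas number ($L_0=2$, $L_1=1$, $L_n=L_{n-1}+L_{n-2}$) and $q_L=(L_p-1)/p$ is the Lucas quotient (equivalently $q_L=(x^p+(1-x)^p-1)/p$ at $x=\phi_{\pm}$). $B_n$ is the $n$-th Bernoulli number and $\left(\frac{\cdot}{p}\right)$... more precisely $\left(\frac{p}{5}\right)$ is the Legendre symbol. Congruences modulo $p$ are taken in the ring of elements of $\mathbb{Q}(\sqrt5)$ integral at all primes above $p$: $a\equiv b\pmod p$ means $(a-b)/p$ is such an element. *)

(* Defs.v *)
From HB Require Import structures.
From mathcomp Require Import all_boot all_order all_algebra all_field.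
From mathcomp Require Import ring.

Set Implicit Arguments.
Unset Strict Implicit.
Unset Printing Implicit Defensive.

Import Order.TTheory GRing.Theory Num.Theory.
Local Open Scope ring_scope.

Definition sqrt5 : algC := sqrtC 5.

Definition Qsqrt5 : {pred algC} := Crat_span [:: 1; sqrt5].

Lemma Qsqrt5P x :
  reflect (exists a b : rat, x = ratr a + ratr b * sqrt5) (x \in Qsqrt5).
Proof.
apply: (iffP (Crat_spanP _ _)) => [[a ->]|[a [b ->]]].
  exists (a ord0), (a (lift ord0 ord0)).
  by rewrite !big_ord_recl big_ord0 /= mulr1 addr0.
exists [ffun i : 'I_2 => if i == ord0 then a else b].
by rewrite !big_ord_recl big_ord0 /= !ffunE /= mulr1 addr0.
Qed.

Fact Qsqrt5_subring : subring_closed Qsqrt5.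
Proof.
split=> [|x y|_ _ /Qsqrt5P[a [b ->]] /Qsqrt5P[c [d ->]]].
- by apply/Qsqrt5P; exists 1, 0; rewrite rmorph1 rmorph0 mul0r addr0.
- exact: rpredB.
apply/Qsqrt5P; exists (a * c + 5 * (b * d)), (a * d + b * c).
have e : sqrt5 ^+ 2 = 5 by rewrite sqrtCK.
by rewrite [in RHS]rmorphD [X in _ = _ + X * _]rmorphD !rmorphM /= ratr_nat -e; ring.
Qed.

HB.instance Definition _ := GRing.isSubringClosed.Build _ Qsqrt5 Qsqrt5_subring.

Definition OQsqrt5_pred : {pred algC} := [predI Qsqrt5 & Aint].

Fact OQsqrt5_subring : subring_closed OQsqrt5_pred.
Proof.
by split=> [|x y /andP[xQ xZ] /andP[yQ yZ]|x y /andP[xQ xZ] /andP[yQ yZ]];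
  rewrite inE /= ?rpred1 ?rpredB ?rpredM.
Qed.

HB.instance Definition _ :=
  GRing.isSubringClosed.Build _ OQsqrt5_pred OQsqrt5_subring.

Definition OQsqrt5 : Type := {x : algC | x \in OQsqrt5_pred}.
HB.instance Definition _ := SubChoice.on OQsqrt5.
HB.instance Definition _ := [SubChoice_isSubComNzRing of OQsqrt5 by <:].

(* x lies in the localization of the ring of integers at P. *)
Definition integral_at (P : prime_idealr OQsqrt5) (x : algC) : Prop :=
  exists a b : OQsqrt5, b \notin P /\ x = val a / val b.

Definition integral_above (p : nat) (x : algC) : Prop :=
  x \in Qsqrt5 /\
  forall P : prime_idealr OQsqrt5, p%:R \in P -> integral_at P x.

Definition congr_mod (p : nat) (a b : algC) : Prop :=
  integral_above p ((a - b) / p%:R).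

(* phi false = phi_+ and phi true = phi_-, so that (-1) ^+ s is the sign +-. *)
Definition phi (s : bool) : algC := (1 + (-1) ^+ s * sqrt5) / 2.

Definition finpolylog (F : fieldType) (p d : nat) (x : F) : F :=
  \sum_(1 <= k < p) x ^+ k / k%:R ^+ d.

Fixpoint lucas (n : nat) : nat :=
  if n is n'.+1 then (if n' is n''.+1 then lucas n' + lucas n'' else 1)%N
  else 2%N.

Definition lucas_quotient (p : nat) : rat := ((lucas p)%:R - 1) / p%:R.

(* The list B_0, ..., B_(n-1), from sum_(k <= m) 'C(m+1, k) B_k = [m = 0]
   (the convention B_1 = -1/2). *)
Fixpoint bernoulli_seq (n : nat) : seq rat :=
  if n is m.+1 then
    let s := bernoulli_seq m in
    rcons s (((m == 0)%:R - \sum_(k < m) 'C(m.+1, k)%:R * s`_k) / m.+1%:R)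
  else [::].

Definition bernoulli (n : nat) : rat := (bernoulli_seq n.+1)`_n.

Lemma size_bernoulli_seq n : size (bernoulli_seq n) = n.
Proof. by elim: n => //= n IHn; rewrite size_rcons IHn. Qed.

Lemma nth_bernoulli_seq n k : (k < n)%N -> (bernoulli_seq n)`_k = bernoulli k.
Proof.
elim: n => // n IHn; rewrite ltnS leq_eqVlt => /predU1P[-> //|ltkn].
by rewrite /= nth_rcons size_bernoulli_seq ltkn IHn.
Qed.

Lemma bernoulli_rec n :
  \sum_(k < n.+1) 'C(n.+1, k)%:R * bernoulli k = (n == 0)%:R.
Proof.
rewrite big_ord_recr /= {2}/bernoulli /= nth_rcons size_bernoulli_seq ltnn eqxx.
rewrite binSn [n.+1%:R * _]mulrC divfK ?pnatr_eq0 //.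
under [X in _ - X]eq_bigr => k _ do rewrite nth_bernoulli_seq //.
by rewrite addrC subrK.
Qed.

(* The Legendre symbol (a / q), for q an odd prime. *)
Definition legendre (a q : nat) : int :=
  if (q %| a)%N then 0
  else if [exists x : 'I_q, x ^ 2 == a %[mod q]]%N then 1 else -1.

(* Main.v *)
Require Import Defs.
From mathcomp Require Import all_boot all_order all_algebra all_field.
From mathcomp Require Import ring zify.

(** Write £_d for [finpolylog p d], X = x^p, and let F be a field of
    characteristic p.  Over F, X has derivative 0 and x £_d'(x) = £_(d-1)(x), so
    an identity between £_d(x), £_d(1-x) and X £_d(1-1/x) with coefficients in
    F[X] can be checked by differentiating, up to a polynomial in X of small
    degree, which a few values and coefficients determine.  This gives
      £_2(x) = £_2(1-x) + X £_2(1-1/x),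
      £_1(x)^2 = - 2 X £_2(x) - 2 (1-X) £_2(1-x),
      6 (X £_3(x) + (1-X) £_3(1-x) + X^2 (1-X) £_3(1-1/x))
        = £_1(x)^3 + 2 B_(p-3) X (1-X);
    the Bernoulli number appears as minus half the coefficient of x^p in
    £_1(x)^3, that is, as the sum of 1/(i k^2) over 0 < i < k < p.
    If x^2 = x + 1 then 1-x = -1/x and 1-1/x = x^(-2), and together with the
    inversion and duplication formulas these identities become a linear system
    for £_d(x), £_d(-x), £_d(x^2), whose solution involves only £_1(x) = - q_L
    and X, where 2X - 1 = (p/5) (2x - 1).
    A congruence modulo p in Q(sqrt 5) is an equality between the images of both
    sides under the two reductions of phi to roots of x^2 = x + 1 in F. *)
Set Implicit Arguments.
Unset Strict Implicit.
Unset Printing Implicit Defensive.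

Import GRing.Theory Num.Theory.
Local Open Scope ring_scope.

(** * Polynomial identities in characteristic p *)

Section CharP.

Variables (F : fieldType) (p : nat).
Hypothesis (charFp : p \in [pchar F]).

Let p_prime : prime p := pcharf_prime charFp.

Lemma natr_pchar_neq0 k : (0 < k < p)%N -> k%:R != 0 :> F.
Proof.
by case/andP=> k_gt0 k_ltp; rewrite -(dvdn_pcharf charFp) gtnNdvd.
Qed.

Lemma expXp_B (R : comNzRingType) (charRp : p \in [pchar R]) (x y : R) :
  (x - y) ^+ p = x ^+ p - y ^+ p.
Proof.
have pn : [pchar R].-nat p by rewrite (eq_pnat _ (pcharf_eq charRp)) pnat_id.
by rewrite exprDn_pchar // exprNn_pchar.
Qed.

Lemma deriv_eq0_coef (f : {poly F}) i : f^`() = 0 -> ~~ (p %| i)%N -> f`_i = 0.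
Proof.
move=> df0 pNi; case: i pNi => [|i]; first by rewrite dvdn0.
move=> pNi; have: f^`()`_i = 0 by rewrite df0 coef0.
rewrite coef_deriv -mulr_natr => /eqP; rewrite mulf_eq0 -(dvdn_pcharf charFp).
by rewrite (negPf pNi) orbF => /eqP.
Qed.

(** A zero derivative leaves only exponents divisible by p, and the size bound reduces these to 0, p
    and 2p. *)
Lemma deriv_eq0_poly3 (f : {poly F}) : f^`() = 0 -> (size f <= 3 * p)%N ->
  f = (f`_0)%:P + f`_p *: 'X^p + f`_(2 * p) *: 'X^(2 * p).
Proof.
move=> df0 sf; have p_gt1 := prime_gt1 p_prime; apply/polyP=> i.
rewrite !coefD coefC !coefZ !coefXn.
have [/dvdnP[k ->]|pNi] := boolP (p %| i)%N; last first.
  rewrite deriv_eq0_coef //; move: pNi.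
  have [->|_] := eqVneq i 0%N; first by rewrite dvdn0.
  have [->|_] := eqVneq i p; first by rewrite dvdnn.
  have [->|_] := eqVneq i (2 * p)%N; first by rewrite dvdn_mull.
  by rewrite !mulr0 !addr0.
case: k => [|[|[|k]]].
- by rewrite mul0n eqxx (ltn_eqF (ltnW p_gt1)) ltn_eqF ?mulr0 ?addr0 //; lia.
- rewrite mul1n eqxx gtn_eqF ?(ltnW p_gt1) // ltn_eqF; last by lia.
  by rewrite mulr1 mulr0 add0r addr0.
- rewrite eqxx [_ == 0%N]gtn_eqF; last by lia.
  by rewrite gtn_eqF ?mulr0 ?mulr1 ?add0r //; lia.
rewrite nth_default; last by apply: leq_trans sf _; nia.
rewrite 3?gtn_eqF ?mulr0 ?addr0 //; nia.
Qed.

Lemma deriv_eq0_poly1 (f : {poly F}) :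
  f^`() = 0 -> (size f <= p)%N -> f`_0 = 0 -> f = 0.
Proof.
move=> df0 sf f0; have p_gt1 := prime_gt1 p_prime.
rewrite (deriv_eq0_poly3 df0); last by lia.
have [fp f2p] : f`_p = 0 /\ f`_(2 * p) = 0
  by split; apply: nth_default => //; apply: leq_trans sf _; lia.
by rewrite f0 fp f2p !scale0r !addr0.
Qed.

Lemma size_polyD_le (f g : {poly F}) n :
  (size f <= n)%N -> (size g <= n)%N -> (size (f + g)%R <= n)%N.
Proof.
by move=> sf sg; rewrite (leq_trans (size_polyD _ _)) // geq_max sf sg.
Qed.

Lemma size_polyM_le (f g : {poly F}) m n :
  (size f <= m)%N -> (size g <= n)%N -> (size (f * g)%R <= (m + n).-1)%N.
Proof.
move=> sf sg; apply: leq_trans (size_polyMleq _ _) _.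
by rewrite -!subn1 leq_sub2r // leq_add.
Qed.

(** Strong induction on the exponent: (k+1)^(n+1) - k^(n+1) summed over k < p telescopes to p^(n+1)
    = 0. Expanded by the binomial theorem, it leaves n+1 times the sum of the k^n, and n+1 is
    invertible. *)
Lemma sum_exp_pchar m : (m.+1 < p)%N -> (0 < m)%N ->
  \sum_(1 <= k < p) k%:R ^+ m = 0 :> F.
Proof.
have p_gt1 := prime_gt1 p_prime.
suff H n : (n.+1 < p)%N -> \sum_(0 <= k < p) k%:R ^+ n = 0 :> F.
  move=> mp m0; have := H m mp; rewrite big_ltn; last exact: ltnW.
  by rewrite expr0n gtn_eqF // add0r.
elim/ltn_ind: n => n IH np.
have: \sum_(0 <= k < p) (k.+1%:R ^+ n.+1 - k%:R ^+ n.+1) = 0 :> F.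
  by rewrite telescope_sumr ?(ltnW p_gt1) // (pcharf0 charFp) subrr.
under eq_bigr => k _ do rewrite -natr1 exprD1n big_ord_recr /= binn addrK.
rewrite exchange_big big_ord_recr /= big1 ?add0r => [|i _]; last first.
  by have i_lt := ltn_ord i; rewrite sumrMnl IH ?mul0rn //; lia.
rewrite sumrMnl binSn => /eqP; rewrite -mulr_natr mulf_eq0.
by rewrite (negPf (natr_pchar_neq0 _)) ?orbF // => /eqP.
Qed.

Lemma fermat_pchar k : (0 < k < p)%N -> k%:R ^+ p.-1 = 1 :> F.
Proof.
move=> k_bd; apply: (mulfI (natr_pchar_neq0 k_bd)).
rewrite -exprS prednK ?prime_gt0 // mulr1.
by rewrite -(pFrobenius_autE charFp) pFrobenius_aut_nat.
Qed.

Lemma sum_expV_pchar d : (0 < d < p.-1)%N ->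
  \sum_(1 <= k < p) k%:R ^- d = 0 :> F.
Proof.
case/andP=> d_gt0 d_lt; rewrite -[RHS](@sum_exp_pchar (p.-1 - d)); try lia.
apply: eq_big_nat => k k_bd; have k0 := natr_pchar_neq0 k_bd.
apply: (mulfI (expf_neq0 d k0)); rewrite mulfV ?expf_neq0 // -exprD.
by rewrite subnKC ?fermat_pchar //; lia.
Qed.

(** * Finite polylogarithms as polynomials, and their derivatives *)

Definition plog d : {poly F} := \sum_(1 <= k < p) k%:R ^- d *: 'X^k.

Definition plog1 d : {poly F} := plog d \Po (1 - 'X).

(* ['X^p] times £_d(1 - 1/'X). *)
Definition plogV d : {poly F} :=
  \sum_(1 <= k < p) k%:R ^- d *: ('X^(p - k) * ('X - 1) ^+ k).

Lemma horner_plog d (x : F) : (plog d).[x] = finpolylog p d x.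
Proof.
by rewrite horner_sum; apply: eq_bigr => k _; rewrite hornerZ hornerXn mulrC.
Qed.

Lemma horner_plog1 d (x : F) : (plog1 d).[x] = finpolylog p d (1 - x).
Proof. by rewrite horner_comp !hornerE horner_plog. Qed.

Lemma horner_plogV d (x : F) : x != 0 ->
  (plogV d).[x] = x ^+ p * finpolylog p d (1 - x^-1).
Proof.
move=> x0; rewrite horner_sum mulr_sumr; apply: eq_big_nat => k /andP[_ kp].
rewrite hornerZ hornerM hornerXn horner_exp hornerD hornerN hornerX -polyC1.
rewrite hornerC mulrC -mulrA.
rewrite -{2}(subnK (ltnW kp)) exprD -!mulrA; congr (_ * _).
by rewrite [in RHS]mulrA -exprMn mulrBr mulr1 mulfV.
Qed.

Lemma coef_plog d i : (plog d)`_i = if (0 < i < p)%N then i%:R ^- d else 0.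
Proof.
rewrite coef_sum; under eq_bigr do rewrite coefZ coefXn.
case: ifPn => [i_bd|i_nbd].
  rewrite (bigD1_seq i) ?mem_index_iota ?iota_uniq //= eqxx mulr1.
  by rewrite big1 ?addr0 // => k kNi; rewrite eq_sym (negPf kNi) mulr0.
rewrite big_nat big1 // => k k_bd; case: eqP => [ik|_]; last exact: mulr0.
by rewrite ik k_bd in i_nbd.
Qed.

Lemma size_plog d : (size (plog d) <= p)%N.
Proof.
by apply/leq_sizeP => j pj; rewrite coef_plog [(j < p)%N]ltnNge pj andbF.
Qed.

Lemma size_plog1 d : (size (plog1 d) <= p)%N.
Proof.
rewrite size_comp_poly2 ?size_plog // -opprB size_polyN -polyC1.
exact: size_XsubC.
Qed.

Lemma finpolylog0 d : finpolylog p d (0 : F) = 0.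
Proof.
by rewrite -horner_plog horner_coef0 coef_plog.
Qed.

Lemma finpolylog1 d : (0 < d < p.-1)%N -> finpolylog p d (1 : F) = 0.
Proof.
move=> d_bd; rewrite -(sum_expV_pchar d_bd).
by apply: eq_bigr => k _; rewrite expr1n mul1r.
Qed.

(** Each summand has degree p and leading coefficient [k%:R ^- d]; these add up to a vanishing power
    sum, so the term in ['X^p] cancels. *)
Lemma size_plogV d : (0 < d < p.-1)%N -> (size (plogV d) <= p)%N.
Proof.
move=> d_bd; apply/leq_sizeP => j pj; rewrite coef_sum.
transitivity (\sum_(1 <= k < p) k%:R ^- d * (j == p)%:R : F); last first.
  by rewrite -mulr_suml sum_expV_pchar // mul0r.
apply: eq_big_nat => k k_bd; rewrite coefZ; congr (_ * _).
have sXk : size (('X - 1 : {poly F}) ^+ k) = k.+1.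
  by rewrite -polyC1 size_exp_XsubC.
have k_lt : (k < p)%N by case/andP: k_bd.
rewrite coefXnM ltnNge (leq_trans (leq_subr _ _) pj) /=.
have [->|jNp] := eqVneq j p.
  rewrite subKn ?(ltnW k_lt) //; have := lead_coef_exp ('X - 1 : {poly F}) k.
  by rewrite -polyC1 lead_coefXsubC expr1n /lead_coef polyC1 sXk.
rewrite nth_default // sXk; lia.
Qed.

Lemma plogV_coef0 d : (plogV d)`_0 = 0.
Proof.
rewrite -horner_coef0 horner_sum big_nat big1 // => k /andP[_ kp].
rewrite !(hornerE, horner_exp) expr0n subn_eq0 leqNgt kp /=.
by rewrite mulr0 mul0r.
Qed.

Lemma deriv_plog d : 'X * (plog d.+1)^`() = plog d.
Proof.
rewrite raddf_sum mulr_sumr; apply: eq_big_nat => k k_bd /=.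
rewrite derivZ derivXn -scalerAr mulrnAr -exprS prednK; last by case/andP: k_bd.
rewrite -['X^k *+ k]scaler_nat scalerA; congr (_ *: _).
by rewrite exprS invfM mulrAC mulVf ?mul1r // natr_pchar_neq0.
Qed.

Lemma deriv_plog1 d : ('X - 1) * (plog1 d.+1)^`() = plog1 d.
Proof.
rewrite deriv_comp derivB derivX -polyC1 derivC sub0r mulrN1 mulrN -mulNr opprB.
by rewrite /plog1 -(deriv_plog d) comp_polyM comp_polyX polyC1.
Qed.

(** Since p - k = -k in F, the product rule yields the factor -k(X - 1) + kX = k, which cancels one
    power of k in the denominator. *)
Lemma deriv_plogV d : 'X * ('X - 1) * (plogV d.+1)^`() = plogV d.
Proof.
rewrite raddf_sum mulr_sumr; apply: eq_big_nat => k k_bd /=.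
have [k_gt0 k_lt] := andP k_bd.
rewrite derivZ derivM derivXn deriv_exp derivB derivX -polyC1 derivC subr0.
rewrite mul1r.
rewrite polyC1 -scalerAr.
have -> : 'X * ('X - 1) * (('X^((p - k).-1) *+ (p - k)) * ('X - 1) ^+ k +
    'X^(p - k) * (('X - 1) ^+ k.-1 *+ k))
    = k%:R *: ('X^(p - k) * ('X - 1) ^+ k) :> {poly F}.
  have pk : (p - k)%:R = - k%:R :> {poly F}.
    by rewrite natrB ?(ltnW k_lt) // -(polyC_natr F p) (pcharf0 charFp) sub0r.
  have e1 : 'X^(p - k) = 'X * 'X^((p - k).-1) :> {poly F}.
    by rewrite -exprS prednK // subn_gt0.
  have e2 : ('X - 1) ^+ k = ('X - 1) * ('X - 1) ^+ k.-1 :> {poly F}.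
    by rewrite -exprS prednK.
  rewrite -[_ *+ (p - k)]mulr_natr pk -[_ *+ k]mulr_natr.
  by rewrite -mul_polyC polyC_natr e1 e2; ring.
rewrite scalerA; congr (_ *: _).
by rewrite exprS invfM mulrAC mulVf ?mul1r // natr_pchar_neq0.
Qed.

Let charPp : p \in [pchar {poly F}].
Proof. exact: rmorph_pchar (polyC : {rmorphism F -> {poly F}}) _ charFp. Qed.

Lemma plog_0 : (1 - 'X) * plog 0 = 'X - 'X^p.
Proof.
have p_gt0 := prime_gt0 p_prime.
rewrite /plog; under eq_bigr do rewrite expr0 invr1 scale1r.
rewrite mulrC mulr_suml; under eq_bigr do rewrite mulrBr mulr1 -exprSr.
rewrite -[LHS]opprK -sumrN; under eq_bigr do rewrite opprB.
by rewrite telescope_sumr // opprB expr1.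
Qed.

Lemma plog_0_opp : ('X - 1) * plog 0 = 'X^p - 'X.
Proof. by rewrite -[LHS]opprK -mulNr opprB plog_0 opprB. Qed.

Lemma plog1_0 : 'X * plog1 0 = 'X^p - 'X.
Proof.
have -> : 'X * plog1 0 = ((1 - 'X) * plog 0) \Po (1 - 'X).
  by rewrite comp_polyM comp_polyB comp_polyX -polyC1 comp_polyC polyC1 subKr.
rewrite plog_0 comp_polyB comp_polyX comp_Xn_poly expXp_B // expr1n.
by rewrite opprB addrC addrA subrK.
Qed.

Lemma plogV_0 : plogV 0 = 'X - 'X^p.
Proof.

(* The difference [f k.+1 - f k] is the k-th summand, because X - (X - 1) = 1. *)
pose f k : {poly F} := - ('X^(p.+1 - k) * ('X - 1) ^+ k).
have p_gt0 := prime_gt0 p_prime.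
transitivity (\sum_(1 <= k < p) (f k.+1 - f k)).
  apply: eq_big_nat => k /andP[k_gt0 k_lt].
  rewrite expr0 invr1 scale1r /f subSS subSn ?(ltnW k_lt) // !exprS.
  by ring.
rewrite telescope_sumr // /f subSn // subnn subSS subn0 expr1.
by rewrite expXp_B // expr1n expr1; ring.
Qed.

Lemma derivXp : ('X^p : {poly F})^`() = 0.
Proof. by rewrite derivXn mulrn_pchar. Qed.

Lemma size_one_subXp : (size (1 - 'X^p : {poly F})%R <= p.+1)%N.
Proof. by rewrite -opprB size_polyN size_Xn_sub_1 ?prime_gt0. Qed.

Lemma deriv_eq0 (f : {poly F}) : 'X * ('X - 1) * f^`() = 0 -> f^`() = 0.
Proof.
move/eqP; rewrite !mulf_eq0 polyX_eq0 /= -polyC1 polyXsubC_eq0 /=.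
by move/eqP.
Qed.

(** * Functional equations in weights one, two and three *)

Hypothesis p_gt5 : (5 < p)%N.

(** Together with [plogV_1], this expresses the derivatives of all weight-two terms through [plog 1]
    alone. *)
Lemma plog1_1 : plog1 1 = plog 1.
Proof.
apply/eqP; rewrite -subr_eq0; apply/eqP; apply: deriv_eq0_poly1.
- apply: deriv_eq0; rewrite derivB.
  transitivity ('X * (('X - 1) * (plog1 1)^`())
    + (1 - 'X) * ('X * (plog 1)^`())).
    by ring.
  by rewrite deriv_plog1 deriv_plog plog1_0 plog_0 addrA subrK subrr.
- rewrite (leq_trans (size_polyD _ _)) // size_polyN geq_max.
  by rewrite size_plog size_plog1.
rewrite -horner_coef0 hornerD hornerN horner_plog horner_plog1 finpolylog0.
by rewrite !subr0 finpolylog1 //; lia.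
Qed.

Lemma plogV_1 : plogV 1 = - plog 1.
Proof.
apply/eqP; rewrite -addr_eq0; apply/eqP; apply: deriv_eq0_poly1.
- apply: deriv_eq0; rewrite derivD mulrDr deriv_plogV plogV_0.
  transitivity ('X - 'X^p - (1 - 'X) * ('X * (plog 1)^`())); first by ring.
  by rewrite deriv_plog plog_0 subrr.
- rewrite (leq_trans (size_polyD _ _)) // geq_max.
  by rewrite size_plog size_plogV //; lia.
by rewrite coefD plogV_coef0 coef_plog add0r.
Qed.

Lemma plog_2_landen : plog 2 = plog1 2 + plogV 2.
Proof.
apply/eqP; rewrite -subr_eq0; apply/eqP; apply: deriv_eq0_poly1.
- apply: deriv_eq0; rewrite derivB derivD.
  transitivity (('X - 1) * ('X * (plog 2)^`()) - 'X * (('X - 1) * (plog1 2)^`())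
    - 'X * ('X - 1) * (plogV 2)^`()); first by ring.
  by rewrite deriv_plog deriv_plog1 deriv_plogV plog1_1 plogV_1; ring.
- rewrite (leq_trans (size_polyD _ _)) // size_polyN geq_max size_plog.
  rewrite (leq_trans (size_polyD _ _)) // geq_max.
  by rewrite size_plog1 size_plogV //; lia.
rewrite coefB coefD plogV_coef0 coef_plog addr0 sub0r.
rewrite -horner_coef0 horner_plog1 subr0 finpolylog1 ?oppr0 //; lia.
Qed.

(** The difference f of the two sides has zero derivative and degree below 2p, so it is a constant
    plus a multiple of ['X^p]; f(0) = 0 and f(1) = 0 remove both. *)
Lemma plog_1_sqr :
  plog 1 ^+ 2 = - (2 * ('X^p * plog 2 + (1 - 'X^p) * plog1 2)).
Proof.
apply/eqP; rewrite -addr_eq0; apply/eqP; set f := _ + _.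
have df : f^`() = 0.
  apply: deriv_eq0.
  rewrite /f derivD deriv_exp -[2]polyC_natr !(derivM, derivD, derivN, derivC).
  rewrite derivXp.
  transitivity (2 * plog 1 * (('X - 1) * ('X * (plog 1)^`()))
    + 2 * 'X^p * ('X - 1) * ('X * (plog 2)^`())
    + 2 * (1 - 'X^p) * 'X * (('X - 1) * (plog1 2)^`())).
    by rewrite polyC_natr; ring.
  rewrite !(deriv_plog, deriv_plog1) plog1_1.
  rewrite plog_0_opp.
  by ring.
have p2 : (2 * p = (1 + (p.+1 + p).-1).-1)%N by lia.
have sf : (size f <= 2 * p)%N.
  apply: size_polyD_le.
    apply: leq_trans (size_polyM_le (size_plog 1) (size_plog 1)) _; lia.
  rewrite p2; apply: size_polyM_le.
    by rewrite -polyC_natr size_polyC_leq1.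
  apply: size_polyD_le; apply: size_polyM_le;
    rewrite ?size_polyXn ?size_plog ?size_plog1 //.
  exact: size_one_subXp.
have s3 : (size f <= 3 * p)%N by apply: leq_trans sf _; lia.
have f0 : f`_0 = 0.
  rewrite -horner_coef0 /f !(hornerE, horner_exp) !horner_plog horner_plog1.
  rewrite subr0 !finpolylog0 finpolylog1; last by lia.
  by rewrite !(mulr0, expr0n, addr0).
have f2p : f`_(2 * p) = 0 by exact: nth_default.
have := deriv_eq0_poly3 df s3; rewrite f0 f2p scale0r addr0 add0r => fE.
have : f.[1] = 0.
  rewrite /f !(hornerE, horner_exp) !horner_plog horner_plog1.
  rewrite !finpolylog1 ?expr1n ?subrr; try lia.
  by rewrite !(mulr0, expr0n, mul0r, addr0).
by rewrite {1}fE hornerZ hornerXn expr1n mulr1 => fp; rewrite fE fp scale0r.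
Qed.

(** Differentiating lands in weight two, where [plog_1_sqr] and [plog_2_landen] cancel everything.
    In the remaining c_0 + c_1 X^p + c_2 X^(2p), the value at 0 gives c_0 = 0 and the value at 1
    gives c_2 = -c_1. *)
Lemma plog_3_landen :
  6 * ('X^p * plog 3 + (1 - 'X^p) * plog1 3 + 'X^p * (1 - 'X^p) * plogV 3)
    - plog 1 ^+ 3
  = - (plog 1 ^+ 3)`_p *: ('X^p * (1 - 'X^p)).
Proof.
set f := LHS.
have df : f^`() = 0.
  apply: deriv_eq0.
  rewrite /f derivB deriv_exp -[6]polyC_natr !(derivM, derivD, derivN, derivC).
  rewrite derivXp.
  transitivity (6 * ('X^p * ('X - 1) * ('X * (plog 3)^`())
      + (1 - 'X^p) * 'X * (('X - 1) * (plog1 3)^`())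
      + 'X^p * (1 - 'X^p) * ('X * ('X - 1) * (plogV 3)^`()))
    - 3 * plog 1 ^+ 2 * (('X - 1) * ('X * (plog 1)^`()))).
    by rewrite polyC_natr; ring.
  rewrite !(deriv_plog, deriv_plog1, deriv_plogV) plog_1_sqr plog_2_landen.
  rewrite plog_0_opp.
  by ring.
have sf : (size f <= 3 * p)%N.
  have p3 : (3 * p = (1 + ((p.+1 + p.+1).-1 + p).-1).-1)%N by lia.
  apply: size_polyD_le.
    rewrite p3; apply: size_polyM_le.
      by rewrite -polyC_natr size_polyC_leq1.
    apply: size_polyD_le; last first.
      apply: size_polyM_le; last by apply: size_plogV; lia.
      by apply: size_polyM_le; rewrite ?size_polyXn ?size_one_subXp.
    have pp : ((p.+1 + p).-1 <= ((p.+1 + p.+1).-1 + p).-1)%N by lia.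
    apply: leq_trans pp.
    apply: size_polyD_le; apply: size_polyM_le;
      rewrite ?size_polyXn ?size_plog ?size_plog1 //.
    exact: size_one_subXp.
  rewrite size_polyN exprS expr2.
  have sL := size_plog 1; have := size_polyM_le sL (size_polyM_le sL sL).
  move=> sL3; apply: leq_trans sL3 _; lia.
have f0 : f`_0 = 0.
  rewrite -horner_coef0 /f !(hornerE, horner_exp) !horner_plog horner_plog1.
  rewrite subr0 !finpolylog0 finpolylog1; last by lia.
  rewrite expr0n gtn_eqF ?prime_gt0 //.
  by rewrite !(mulr0, expr0n, mul0r, addr0, subr0).
(* Only the cube contributes in degree p: [plog 3] and [plogV 3] have no constant term, while
   [plog1 3] has size at most p and constant term £_3(1) = 0. *)
have fp : f`_p = - (plog 1 ^+ 3)`_p.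
  rewrite coefB mulr_natl coefMn !coefD coefXnM ltnn subnn -mulrA coefXnM ltnn.
  rewrite subnn mulrBl mul1r coefB coefXnM ltnn subnn coef0M plogV_coef0 mulr0.
  rewrite coef_plog /= -horner_coef0 horner_plog1 subr0.
  rewrite finpolylog1; last by lia.
  by rewrite nth_default ?size_plog1 // addr0 add0r subr0 mul0rn sub0r.
have := deriv_eq0_poly3 df sf; rewrite f0 fp add0r => fE.
have : f.[1] = 0.
  rewrite /f !(hornerE, horner_exp) !horner_plog horner_plog1.
  rewrite !finpolylog1 ?expr1n ?subrr; try lia.
  by rewrite !(mulr0, expr0n, mul0r, addr0, subr0).
rewrite {1}fE hornerD !hornerZ !hornerXn !expr1n !mulr1 => /eqP.
rewrite addrC addr_eq0 opprK => /eqP f2p; rewrite fE f2p.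
by rewrite mulnC exprM expr2 mulrBr mulr1 scalerBr !scaleNr opprK.
Qed.

(** * The Bernoulli number as a coefficient of £_1(x)^3 *)

Lemma coef_plog_sqr k : (0 < k <= p)%N ->
  (plog 1 ^+ 2)`_k *+ k = 2 * \sum_(1 <= i < k) i%:R^-1.
Proof.
case/andP=> k_gt0 k_le.
(* All coefficients of [plog 0] in degrees 1 to p-1 are 1, so multiplying by it forms partial sums
   of the coefficients 1/i of [plog 1]. *)
have e : 'X * (plog 1 ^+ 2)^`() = 2 * (plog 1 * plog 0).
  by rewrite deriv_exp expr1 -(deriv_plog 0); ring.
have := congr1 (fun f : {poly F} => f`_k) e.
rewrite coefXM gtn_eqF // coef_deriv prednK // => ->.
rewrite mulr_natl coefMn mulr_natl coefM; congr (_ *+ 2).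
rewrite big_ord_recr /= subnn [(plog 0)`_0]coef_plog mulr0 addr0.
rewrite -(big_mkord xpredT (fun j => (plog 1)`_j * (plog 0)`_(k - j))).
rewrite big_ltn // coef_plog mul0r add0r.
apply: eq_big_nat => i /andP[i_gt0 i_lt].
rewrite !coef_plog i_gt0 (leq_trans i_lt) // subn_gt0 i_lt /=.
by rewrite ifT ?expr0 ?invr1 ?mulr1 ?expr1 //; lia.
Qed.

(** One factor 1/k comes from [coef_plog_sqr], the other, with the sign, from 1/(p-k) = -1/k. *)
Lemma coef_plog_cube : (plog 1 ^+ 3)`_p =
  - (2 * \sum_(1 <= k < p) (\sum_(1 <= i < k) i%:R^-1) / k%:R ^+ 2).
Proof.
have p_gt0 := prime_gt0 p_prime.
rewrite exprSr coefM big_ord_recr /= subnn [(plog 1)`_0]coef_plog mulr0 addr0.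
rewrite -(big_mkord xpredT (fun j => (plog 1 ^+ 2)`_j * (plog 1)`_(p - j))).
rewrite big_ltn // subn0 [(plog 1)`_p]coef_plog ltnn andbF mulr0 add0r.
rewrite -mulrN -sumrN mulr_sumr; apply: eq_big_nat => k k_bd.
have k0 := natr_pchar_neq0 k_bd; have [k_gt0 k_lt] := andP k_bd.
have := @coef_plog_sqr k; rewrite k_gt0 ltnW // => /(_ isT) => Lk.
rewrite coef_plog ifT; last by lia.
rewrite natrB ?(ltnW k_lt) // (pcharf0 charFp) sub0r expr1 invrN.
apply: (mulIf k0); rewrite mulrAC mulr_natr Lk.
by field.
Qed.

(* [P(x) = \sum_(j < N) 'C(N, j) b_j x^(N - j)] is the Bernoulli polynomial
   without its constant term. *)
Lemma faulhaber_step (R : comNzRingType) (b : nat -> R) N (x : R) :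
  (forall n, (n < N)%N ->
    \sum_(k < n.+1) 'C(n.+1, k)%:R * b k = (n == 0%N)%:R) ->
  \sum_(j < N) 'C(N, j)%:R * b j * ((x + 1) ^+ (N - j) - x ^+ (N - j))
  = N%:R * x ^+ N.-1.
Proof.
move=> b_rec.
transitivity (\sum_(j < N) \sum_(i < N | (i < N - j)%N)
    'C(N, i)%:R * x ^+ i * ('C(N - i, j)%:R * b j)).
  apply: eq_bigr => j _; rewrite exprD1n big_ord_recr /= binn addrK.
  rewrite mulr_sumr.
  rewrite (big_ord_widen N
    (fun i => 'C(N, j)%:R * b j * (x ^+ i *+ 'C(N - j, i)))) ?leq_subr //.
  apply: eq_bigr => i i_lt.
  (* Both sides are the multinomial coefficient N!/(i! j! (N-i-j)!). *)
  have e : ('C(N, j) * 'C(N - j, i) = 'C(N, i) * 'C(N - i, j))%N.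
    have := ltn_ord j; have := ltn_ord i => iN jN.
    apply/eqP; rewrite -(eqn_pmul2r (fact_gt0 (N - j - i))).
    rewrite -(eqn_pmul2r (fact_gt0 i)) -(eqn_pmul2r (fact_gt0 j)); apply/eqP.
    have ij : (N - i - j = N - j - i)%N by lia.
    have h1 := @bin_fact N j; have h2 := @bin_fact (N - j) i.
    have h3 := @bin_fact N i; have h4 := @bin_fact (N - i) j.
    rewrite ij in h4.
    have h2' := h2 ltac:(lia); have h4' := h4 ltac:(lia).
    have h1' := h1 ltac:(lia); have h3' := h3 ltac:(lia).
    transitivity (N`!).
      rewrite -h1' -h2'; ring.
    rewrite -h3' -h4'; ring.
  rewrite -mulr_natr.
  transitivity (('C(N, j) * 'C(N - j, i))%:R * (b j * x ^+ i)).
    by rewrite natrM; ring.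
  by rewrite e natrM; ring.
under eq_bigr do rewrite big_mkcond.
rewrite exchange_big /=.
(* The inner sum over j is the recurrence at n = N - i - 1, so only i = N - 1 survives. *)
transitivity (\sum_(i < N) 'C(N, i)%:R * x ^+ i * (N - i == 1)%N%:R).
  apply: eq_bigr => i _; have iN := ltn_ord i.
  have [n nE] : exists n, (N - i = n.+1)%N by exists (N - i).-1; lia.
  rewrite nE -[RHS]/(_ * (n == 0%N)%:R) -b_rec; last by lia.
  rewrite mulr_sumr (big_ord_widen N
    (fun j => 'C(N, i)%:R * x ^+ i * ('C(n.+1, j)%:R * b j))); last by lia.
  rewrite [RHS]big_mkcond; apply: eq_bigr => j _.
  by congr (if _ then _ else _); apply/idP/idP; lia.
case: N {b_rec} => [|N]; first by rewrite big_ord0 mul0r.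
rewrite big_ord_recr /= subSn // subnn eqxx mulr1 binSn big1 ?add0r // => i _.
have iN := ltn_ord i; rewrite (_ : _ == 1 = false)%N ?mulr0 //; lia.
Qed.

(** For N = p - 1, [faulhaber_step] gives P(i+1) - P(i) = -i^(p-2), that is -1/i for i nonzero, so
    P(k) is minus a harmonic sum. In the sum of P(k)/k^2 all power sums vanish except the one of
    exponent 0, at j = p - 3, where the binomial coefficient is 1 in F. The sequence [b] is abstract
    so that Bernoulli numbers reduced modulo p can be substituted. *)
Lemma sum_harmonic_bernoulli (b : nat -> F) :
  (forall n, (n < p.-1)%N ->
    \sum_(k < n.+1) 'C(n.+1, k)%:R * b k = (n == 0%N)%:R) ->
  \sum_(1 <= k < p) (\sum_(1 <= i < k) i%:R^-1) / k%:R ^+ 2 = b (p - 3)%N.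
Proof.
move=> b_rec; have p_gt0 := prime_gt0 p_prime.
pose P (x : F) := \sum_(j < p.-1) 'C(p.-1, j)%:R * b j * x ^+ (p.-1 - j).
have P0 : P 0 = 0.
  rewrite /P big1 // => j _; have := ltn_ord j => jp.
  by rewrite expr0n gtn_eqF ?mulr0 ?subn_gt0.
have PS i : P i.+1%:R - P i%:R = - i%:R ^+ p.-2.
  rewrite /P -sumrB; under eq_bigr do rewrite -mulrBr -natr1.
  rewrite faulhaber_step //.
  by rewrite -{1}subn1 natrB // (pcharf0 charFp) sub0r mulN1r.
have PH k : (0 < k < p)%N -> P k%:R = - \sum_(1 <= i < k) i%:R^-1.
  case/andP=> k_gt0 k_lt; have := telescope_sumr (fun i => P i%:R) (leq0n k).
  rewrite mulr0n P0 subr0 => <-.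
  rewrite big_ltn // PS expr0n gtn_eqF; last by lia.
  rewrite oppr0 add0r -sumrN; apply: eq_big_nat => i /andP[i_gt0 i_lt].
  rewrite PS; congr (- _).
  have i_bd : (0 < i < p)%N by rewrite i_gt0 (ltn_trans i_lt).
  apply: (mulfI (natr_pchar_neq0 i_bd)); rewrite mulfV ?natr_pchar_neq0 //.
  by rewrite -exprS prednK ?fermat_pchar //; lia.
transitivity (- \sum_(1 <= k < p) P k%:R / k%:R ^+ 2).
  by rewrite -sumrN; apply: eq_big_nat => k k_bd; rewrite PH // mulNr opprK.
under eq_bigr do rewrite mulr_suml.
rewrite exchange_big /=.
have C1 : 'C(p.-1, p - 3)%:R = 1 :> F.
  have -> : (p - 3 = p.-1 - 2)%N by lia.
  rewrite bin_sub; last by lia.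
  have := congr1 (fun n => n%:R : F) (mul_bin_diag p.-1 1).
  rewrite bin1 !natrM -!subn1 -subnDA !natrB //; try lia.
  rewrite (pcharf0 charFp) => h.
  have two : 2%:R != 0 :> F by apply: natr_pchar_neq0; lia.
  by apply: (mulfI two); rewrite -h; ring.
have p3 : (p - 3 < p.-1)%N by lia.
rewrite (bigD1 (Ordinal p3)) //= C1 mul1r.
have e2 : (p.-1 - (p - 3) = 2)%N by lia.
rewrite (eq_big_nat _ _ (F2 := fun=> b (p - 3)%N)) => [|k k_bd]; last first.
  by rewrite e2 mulfK ?expf_neq0 ?natr_pchar_neq0.
rewrite sumr_const_nat -mulr_natr natrB // (pcharf0 charFp) sub0r mulrN1.
rewrite big1 ?addr0 ?opprK // => j; rewrite -val_eqE /= => jN3.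
have jp := ltn_ord j.
under eq_bigr do rewrite -mulrA.
rewrite -mulr_sumr; have [j_lt|j_ge] := ltnP j (p - 3).
  rewrite (eq_big_nat _ _ (F2 := fun k => k%:R ^+ (p - 3 - j))) => [|k k_bd].
    rewrite sum_exp_pchar ?mulr0 //; lia.
  have -> : (p.-1 - j = (p - 3 - j) + 2)%N by lia.
  by rewrite exprD mulfK ?expf_neq0 ?natr_pchar_neq0.
rewrite (eq_big_nat _ _ (F2 := fun k => k%:R ^- 1)) => [|k k_bd].
  rewrite sum_expV_pchar ?mulr0 //; lia.
have -> : (p.-1 - j = 1)%N by lia.
by rewrite expr2 invfM mulrA mulfV ?natr_pchar_neq0 // mul1r expr1.
Qed.

(** * Finite polylogarithms at the golden ratio *)

Lemma finpolylogV d (u : F) : u != 0 ->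
  finpolylog p d u = (-1) ^+ d * u ^+ p * finpolylog p d u^-1.
Proof.
move=> u0; rewrite {1}/finpolylog big_nat_rev mulr_sumr /=.
apply: eq_big_nat => k k_bd; have [k_gt0 k_lt] := andP k_bd.
have kp : (k <= p)%N by exact: ltnW.
rewrite add1n subSS natrB // (pcharf0 charFp) sub0r [(- k%:R) ^+ d]exprNn invfM.
have -> : ((-1) ^+ d)^-1 = (-1) ^+ d :> F by rewrite -exprVn invrN1.
by rewrite exprB ?unitfE // exprVn; ring.
Qed.

Lemma big_nat_odd_even (g : nat -> F) m :
  \sum_(1 <= k < m.*2.+1) g k =
  \sum_(1 <= k < m.+1) g k.*2 + \sum_(1 <= k < m.+1) g k.*2.-1.
Proof.
elim: m => [|m IHm]; first by rewrite !big_geq // addr0.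
rewrite doubleS 2?big_nat_recr //= IHm.
rewrite [in RHS]big_nat_recr //= [X in _ = _ + X]big_nat_recr //= doubleS.
by ring.
Qed.

(** Write 1/k^d as 2^d/(2k)^d. For k up to (p-1)/2 the number 2k is even and below p; beyond, it is
    p plus an odd number, so odd residues carry an extra factor u^p. The even and odd parts of £_d
    at u are half the sum and half the difference of its values at u and -u. *)
Lemma finpolylog_sqr d (u : F) :
  2 * finpolylog p d (u ^+ 2) = 2 ^+ d *
    ((1 + u ^+ p) * finpolylog p d u + (1 - u ^+ p) * finpolylog p d (- u)).
Proof.
have two0 : 2%:R != 0 :> F by apply: natr_pchar_neq0; lia.
have [m pE] : exists m, p = m.*2.+1.
  exists p./2; have := odd_double_half p.
  by case: (even_prime p_prime) => [p_eq2|->]; lia.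
pose g k : F := u ^+ (if odd k then p + k else k) / k%:R ^+ d.
transitivity (2 * (2 ^+ d * \sum_(1 <= k < p) g k)).
  congr (_ * _); rewrite [in RHS]pE big_nat_odd_even.
  rewrite /finpolylog {1}pE (big_cat_nat (n := m.+1)) //=; last by lia.
  rewrite mulrDr; congr (_ + _).
    rewrite mulr_sumr; apply: eq_big_nat => k k_bd.
    have k0 : k%:R != 0 :> F by apply: natr_pchar_neq0; lia.
    rewrite /g odd_double -exprM mul2n -mul2n natrM exprMn invfM.
    by rewrite [in RHS]mulrCA mulVKf ?expf_neq0.
  rewrite -(add1n m) big_addn (_ : (m.*2.+1 - m = 1 + m)%N); last by lia.
  rewrite mulr_sumr; apply: eq_big_nat => k k_bd.
  have k0 : (k + m)%:R != 0 :> F by apply: natr_pchar_neq0; lia.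
  have -> : g k.*2.-1 = u ^+ (2 * (k + m)) / (2 * (k + m))%:R ^+ d.
    rewrite /g ifT; last by lia.
    congr (_ ^+ _ / _ ^+ d); first by lia.
    by rewrite -[LHS]addr0 -(pcharf0 charFp) -natrD; congr (_%:R); lia.
  rewrite natrM [(2%:R * _) ^+ d]exprMn invfM exprM.
  by rewrite [in RHS]mulrCA mulVKf ?expf_neq0.
rewrite mulrCA; congr (_ * _); rewrite /finpolylog !mulr_sumr -big_split /=.
apply: eq_big_nat => k k_bd; rewrite /g exprNn -signr_odd.
by case: ifP => _; rewrite ?exprD ?expr0 ?expr1; ring.
Qed.

(** Here [y] is again a root of the quadratic, so [r] is a square root of 5; its comparison with 2x
    - 1 through the Legendre symbol is left to [psi_frobenius]. *)
Lemma golden_ratio_finpolylog (x : F) (b : nat -> F) : x ^+ 2 = x + 1 ->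
  (forall n, (n < p.-1)%N ->
    \sum_(k < n.+1) 'C(n.+1, k)%:R * b k = (n == 0%N)%:R) ->
  let y := x ^+ p in let q := - finpolylog p 1 x in let r := 2 * y - 1 in
  [/\ finpolylog p 2 x = - (r / 10) * q ^+ 2,
      finpolylog p 2 (x ^+ 2) = - (1 / 2) * (1 + r / 5) * q ^+ 2,
      finpolylog p 2 (- x) = - (1 / 4) * (1 + r / 5) * q ^+ 2 &
      finpolylog p 3 (x ^+ 2)
        = - (2 / 15) * (1 + r) * (1 / 2 * q ^+ 3 + b (p - 3)%N)].
Proof.
move=> x2 b_rec y q r.
have p_gt0 := prime_gt0 p_prime.
have two0 : 2 != 0 :> F by apply: (@natr_pchar_neq0 2); lia.
have three0 : 3 != 0 :> F by apply: (@natr_pchar_neq0 3); lia.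
have five0 : 5 != 0 :> F by apply: (@natr_pchar_neq0 5); lia.
have x0 : x != 0.
  by apply: contra_eq_neq x2 => ->; rewrite expr0n add0r eq_sym oner_eq0.
have y2 : y ^+ 2 - y - 1 = 0.
  have := congr1 (fun z => z ^+ p) x2.
  rewrite -!(pFrobenius_autE charFp) rmorphD rmorphXn rmorph1 /=.
  by rewrite !pFrobenius_autE -/y => ->; ring.
have r2 : r * r = 5.
  transitivity (5 + 4 * (y ^+ 2 - y - 1)); first by rewrite /r; ring.
  by rewrite y2 mulr0 addr0.
have ym1 : (- x)^-1 = 1 - x.
  apply: (mulfI (_ : - x != 0)); rewrite ?oppr_eq0 // mulfV ?oppr_eq0 //.
  by rewrite mulrBr mulr1 mulNr opprK -expr2 x2; ring.
have yp2 : (x ^+ 2)^-1 = 1 - x^-1.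
  apply: (mulfI (expf_neq0 2 x0)); rewrite mulfV ?expf_neq0 //.
  by rewrite mulrBr mulr1 {2}expr2 mulfK // x2; ring.
have Npow : (- x) ^+ p = - y.
  by rewrite -(pFrobenius_autE charFp) rmorphN /= pFrobenius_autE.
have Spow : (x ^+ 2) ^+ p = y ^+ 2 by rewrite exprAC.
have Nx0 : - x != 0 by rewrite oppr_eq0.
have invN d := finpolylogV d Nx0.
have invS d := finpolylogV d (expf_neq0 2 x0).
have dup d := finpolylog_sqr d x.
have := dup 3; have := dup 2.
rewrite (invN 2) (invN 3) (invS 2) (invS 3) ym1 yp2 Npow Spow -/y.
have := congr1 (fun f : {poly F} => f.[x]) plog_3_landen.
have := congr1 (fun f : {poly F} => f.[x]) plog_1_sqr.
have := congr1 (fun f : {poly F} => f.[x]) plog_2_landen.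
rewrite coef_plog_cube (sum_harmonic_bernoulli b_rec) /=.
rewrite -[2 : {poly F}]polyC_natr -[6 : {poly F}]polyC_natr.
rewrite !(horner_exp, hornerX, hornerZ, hornerN, hornerM, hornerD, hornerC).
rewrite !(horner_plog, horner_plog1) !horner_plogV // -/y.
have -> : finpolylog p 1 x = - q by rewrite opprK.
set A2 := finpolylog p 2 x; set A3 := finpolylog p 3 x.
set m2 := finpolylog p 2 _; set m3 := finpolylog p 3 (1 - x).
set n2 := finpolylog p 2 _; set n3 := finpolylog p 3 _.
set c := b _ => landen2 sqr1 landen3 dup2 dup3.
(* Eliminating [A2] between [dup2] and [landen2] gives 2(2 + y)(y n2 + 2 m2) = 0, and 2 + y is
   invertible because (2 + y)(3 - y) = 5. *)
have yn2 : y * n2 = - (2 * m2).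
  have y20 : 2 * (2 + y) != 0.
    rewrite mulf_neq0 //; apply: contraNneq five0 => y2E.
    have -> : 5 = (y ^+ 2 - y - 1) + (3 - y) * (2 + y) :> F by ring.
    by rewrite y2 y2E mulr0 addr0.
  apply: (mulfI y20); apply/eqP; rewrite -subr_eq0; apply/eqP.
  transitivity (- (4 * m2 * (y ^+ 2 - y - 1))
   - (2 * ((-1) ^+ 2 * y ^+ 2 * n2) -
     2 ^+ 2 * ((1 + y) * (m2 + y * n2) + (1 - y) * ((-1) ^+ 2 * - y * m2)))).
    ring.
  by rewrite dup2 landen2 y2 subrr !(mulr0, oppr0, addr0).
have mE : q ^+ 2 = 2 * m2 * r.
  rewrite -[q]opprK sqrrN sqr1 landen2 yn2 /r; ring.
have A2E : A2 = - m2 by rewrite landen2 yn2; ring.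
have C2E : (-1) ^+ 2 * y ^+ 2 * n2 = - (2 * y * m2).
  by transitivity (y * (y * n2)); [ring | rewrite yn2; ring].
have ten : 10 = 2 * 5 :> F by ring.
have four : 4 = 2 * 2 :> F by ring.
have fifteen : 15 = 3 * 5 :> F by ring.
have ten0 : 10 != 0 :> F by rewrite ten mulf_neq0.
have four0 : 4 != 0 :> F by rewrite four mulf_neq0.
have fifteen0 : 15 != 0 :> F by rewrite fifteen mulf_neq0.
have yr : 2 * y = 1 + r by rewrite /r; ring.
have yE : y = (1 + r) / 2 by rewrite -yr mulrC mulKf.
split.
- rewrite A2E mE; transitivity (- (m2 * (r * r) / 5)); last first.
    by field; rewrite ten0 five0.
  by rewrite r2 mulfK.
- rewrite C2E mE yr; transitivity (- (m2 * (r + r * r / 5))); last first.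
    by field; rewrite ?two0 ?five0 ?ten0 ?four0.
  by rewrite r2 divff //; ring.
- rewrite mE yE.
  transitivity (- (m2 * (r + r * r / 5) / 2)); last first.
    by field; rewrite ?two0 ?five0 ?ten0 ?four0.
  by rewrite r2 divff //; field.
rewrite -yr.
(* Multiplied by y, the part y A3 + (1-y) m3 of [landen3] becomes (1+y) A3 + y(1-y) m3, since y^2 =
   y + 1. This is the combination in [dup3], so [A3] and [m3] are eliminated together and only [n3]
   remains. *)
have key : 2 * (15 * (y ^+ 2 * n3)) = 2 * (2 * y * (q ^+ 3 + 2 * c)).
  apply/eqP; rewrite -subr_eq0; apply/eqP.
  transitivity
   (2 * (12 * A3 - 12 * (y ^+ 2 * n3) + 4 * c * y) * (y ^+ 2 - y - 1)
    - 4 * y * (6 * (y * A3 + (1 - y) * m3 + y * (1 - y) * (y * n3)) - (- q) ^+ 3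
        - - - (2 * c) * (y * (1 - y)))
    - 3 * (2 * ((-1) ^+ 3 * y ^+ 2 * n3)
        - 2 ^+ 3 * ((1 + y) * A3 + (1 - y) * ((-1) ^+ 3 * - y * m3)))).
    by ring.
  by rewrite y2 dup3 landen3 !subrr !mulr0 !subr0.
have {}key := mulfI two0 key.
apply: (mulfI fifteen0).
transitivity (- (15 * (y ^+ 2 * n3))); first by ring.
by rewrite key; field; rewrite ?two0 ?fifteen0.
Qed.
End CharP.

(** * Reduction modulo p *)

Lemma phi_sqr s : phi s ^+ 2 = phi s + 1.
Proof.
have e5 : sqrt5 ^+ 2 = 5 by rewrite sqrtCK.
have s2 : ((-1) ^+ s) ^+ 2 = 1 :> algC by rewrite sqrr_sign.
rewrite /phi expr_div_n sqrrD exprMn e5 s2; by field.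
Qed.

Lemma phi_true : phi true = 1 - phi false.
Proof. by rewrite /phi expr0 expr1; field. Qed.

Lemma phiC s : phi (~~ s) = 1 - phi s.
Proof. by case: s; rewrite /= phi_true ?subKr. Qed.

Lemma sqrt5_phi (s : bool) : (-1) ^+ s * sqrt5 = 2 * phi s - 1.
Proof. by rewrite /phi; field. Qed.

Lemma Aint_phi s : phi s \in Aint.
Proof.
apply: (@root_monic_Aint ('X^2 - ('X + 1))).
- by rewrite /root !hornerE phi_sqr subrr.
- apply/monicP; rewrite lead_coefDl ?lead_coefXn // size_polyN size_polyXn.
  by rewrite -polyC1 size_XaddC.
apply/polyOverP => i; rewrite coefB coefD coefXn coefX coef1.
by rewrite rpredB ?rpredD ?rpred_nat.
Qed.

Lemma phi_OQsqrt5 s : phi s \in OQsqrt5_pred.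
Proof.
rewrite inE /= Aint_phi andbT; apply/Qsqrt5P.
exists (1 / 2), ((-1) ^+ s / 2).
by rewrite /phi !rmorphM !fmorphV rmorph1 rmorph_sign rmorph_nat; field.
Qed.

Lemma lucas_phi s n : (lucas n)%:R = phi s ^+ n + (1 - phi s) ^+ n.
Proof.
elim/ltn_ind: n => -[|[|n]] IH; first by rewrite !expr0.
  by rewrite !expr1 addrC subrK.
rewrite /= natrD (IH n) ?(IH n.+1) //.
have step (x : algC) : x ^+ 2 = x + 1 -> x ^+ n.+2 = x ^+ n + x ^+ n.+1.
  by move=> e; rewrite -addn2 exprD e exprSr; ring.
by rewrite !step -?phiC ?phi_sqr //; ring.
Qed.

Lemma legendre5E n : legendre n 5 =
  match (n %% 5)%N with 0 => 0 | 1 | 4 => 1 | _ => -1 end.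
Proof.
rewrite /legendre /dvdn.
have : (n %% 5 < 5)%N by rewrite ltn_mod.
case: (n %% 5)%N => [|[|[|[|[|]]]]] //= _.
- by rewrite ifT //; apply/existsP; exists (inord 1); rewrite inordK.
- by rewrite ifF //; apply/existsP => -[[[|[|[|[|[|]]]]]]].
- by rewrite ifF //; apply/existsP => -[[[|[|[|[|[|]]]]]]].
by rewrite ifT //; apply/existsP; exists (inord 2); rewrite inordK.
Qed.

(** * Bernoulli numbers modulo p *)

Lemma dvdn_fact_fact m n : (m <= n)%N -> (m`! %| n`!)%N.
Proof. by move=> mn; rewrite (fact_split mn) dvdn_mulr. Qed.

(** The recurrence divides by n+1 at each step. This denominator bound is weaker than von
    Staudt-Clausen but makes B_n integral at p for n < p - 1. *)
Lemma bernoulli_fact_int n : (n.+1)`!%:R * bernoulli n \is a Num.int.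
Proof.
elim/ltn_ind: n => n IH.

have e : n.+1%:R * bernoulli n =
    (n == 0%N)%:R - \sum_(k < n) 'C(n.+1, k)%:R * bernoulli k.
  by rewrite -bernoulli_rec big_ord_recr /= binSn [X in X - _]addrC addrK.
rewrite factS mulnC natrM -mulrA e mulrBr mulr_sumr.
rewrite rpredB ?rpredM ?rpred_nat // rpred_sum // => k _.
have /dvdnP[m ->] : ((k.+1)`! %| n`!)%N by exact: dvdn_fact_fact.
rewrite natrM mulrACA; apply: rpredM; last exact: IH.
by apply: rpredM; exact: rpred_nat.
Qed.

Section Reduction.

Variables (F : fieldType) (p : nat).
Hypothesis (charFp : p \in [pchar F]) (p_gt5 : (5 < p)%N).

Let p_prime : prime p := pcharf_prime charFp.

Lemma natr_fact_neq0 n : (n < p)%N -> n`!%:R != 0 :> F.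
Proof.
elim: n => [|n IHn] np; first by rewrite oner_eq0.
by rewrite factS natrM mulf_neq0 ?IHn ?(natr_pchar_neq0 charFp) // ltnW.
Qed.

(** The reduction of B_n when n < p - 1; for larger n the factorial is 0 in F and the quotient takes
    the default value 0. *)
Definition bernoulli_mod n : F :=
  (numq ((n.+1)`!%:R * bernoulli n))%:~R / (n.+1)`!%:R.

Lemma bernoulli_modE n : (n < p.-1)%N ->
  bernoulli_mod n * (n.+1)`!%:R = (numq ((n.+1)`!%:R * bernoulli n))%:~R.
Proof. by move=> np; rewrite divfK // natr_fact_neq0 //; lia. Qed.

(** Multiplying the rational recurrence by (n+1)! gives an identity between integers, which can be
    mapped to F, where (n+1)! is invertible. *)
Lemma bernoulli_mod_rec n : (n < p.-1)%N ->
  \sum_(k < n.+1) 'C(n.+1, k)%:R * bernoulli_mod k = (n == 0%N)%:R.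
Proof.
move=> np; have f0 : (n.+1)`!%:R != 0 :> F by apply: natr_fact_neq0; lia.
pose m k := ((n.+1)`! %/ (k.+1)`!)%N.
have mE (k : 'I_n.+1) : (n.+1)`! = (m k * (k.+1)`!)%N.
  by rewrite /m divnK // dvdn_fact_fact.
pose beta k := numq ((k.+1)`!%:R * bernoulli k).
have eZ : \sum_(k < n.+1) ('C(n.+1, k) * m k)%:Z * beta k
    = ((n.+1)`! * (n == 0))%N%:Z.
  apply: (@intr_inj rat); rewrite rmorph_sum /= -[RHS]/(_%:R) natrM.
  rewrite -bernoulli_rec mulr_sumr; apply: eq_bigr => k _.
  rewrite rmorphM /= numqK ?bernoulli_fact_int // -[_%:~R]/(_%:R) natrM.
  by rewrite (mE k) natrM; ring.
apply: (mulIf f0); rewrite mulr_suml mulrC -natrM [RHS]pmulrn -eZ.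
rewrite rmorph_sum /=; apply: eq_bigr => k _.
rewrite rmorphM /= -[_%:~R in RHS]/(_%:R) natrM -bernoulli_modE; last first.
  by have := ltn_ord k; lia.
by rewrite (mE k) natrM; ring.
Qed.

(** * Gaussian periods and the Frobenius *)

Variable z : F.
Hypothesis z_root : 1 + z + z ^+ 2 + z ^+ 3 + z ^+ 4 = 0.

(* The two roots of [x^2 = x + 1] are written as Gaussian periods of a fifth
   root of unity, so that the Frobenius acts on them through [p %% 5]. *)
Definition psi (t : bool) : F :=
  if t then - (z + z ^+ 4) else - (z ^+ 2 + z ^+ 3).

Lemma psiC t : psi (~~ t) = 1 - psi t.
Proof.
apply/eqP; rewrite -subr_eq0; apply/eqP.
transitivity (- (1 + z + z ^+ 2 + z ^+ 3 + z ^+ 4)); last first.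
  by rewrite z_root oppr0.
by case: t; rewrite /psi /=; ring.
Qed.

Lemma psi_sqr t : psi t ^+ 2 = psi t + 1.
Proof.
apply/eqP; rewrite -subr_eq0; apply/eqP.
(* The second factor is the quotient of psi^2 - psi - 1 by the fifth cyclotomic polynomial in z. *)
transitivity ((1 + z + z ^+ 2 + z ^+ 3 + z ^+ 4) *
  (if t then z ^+ 4 - z ^+ 3 + 2 * z - 1 else z ^+ 2 + z - 1)).
  by case: t; rewrite /psi; ring.
by rewrite z_root mul0r.
Qed.

Lemma psi_neq : psi false != psi true.
Proof.
have five0 : 5 != 0 :> F by apply: (natr_pchar_neq0 charFp (k := 5)); lia.
apply: contraNneq five0 => e.
have h : psi true = 1 - psi false := psiC false; rewrite -e in h.
have -> : 5 = (psi false - (1 - psi false)) ^+ 2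
    - 4 * (psi false ^+ 2 - (psi false + 1)) :> F.
  by ring.
by rewrite -h psi_sqr !subrr mulr0 expr0n subr0.
Qed.

(** Raising to the power p replaces z by z^(p mod 5): the periods are fixed when p is 1 or 4 modulo
    5 and exchanged when p is 2 or 3, and the exchange negates 2 psi - 1. *)
Lemma psi_frobenius t :
  2 * psi t ^+ p - 1 = (legendre p 5)%:~R * (2 * psi t - 1).
Proof.
have z5 : z ^+ 5 = 1.
  apply/eqP; rewrite -subr_eq0; apply/eqP.
  transitivity ((z - 1) * (1 + z + z ^+ 2 + z ^+ 3 + z ^+ 4)); first by ring.
  by rewrite z_root mulr0.
have zp k : (z ^+ k) ^+ p = z ^+ (k * (p %% 5) %% 5).
  by rewrite -exprM modnMmr (expr_mod _ z5).
have psip (u v : F) : (- (u + v)) ^+ p = - (u ^+ p + v ^+ p).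
  by rewrite -!(pFrobenius_autE charFp) rmorphN rmorphD.
have psiE : psi t ^+ p = if t
    then - (z ^+ (1 * (p %% 5) %% 5) + z ^+ (4 * (p %% 5) %% 5))
    else - (z ^+ (2 * (p %% 5) %% 5) + z ^+ (3 * (p %% 5) %% 5)).
  by case: t; rewrite /psi psip ?zp // -{1}[z]expr1 zp.
have : (p %% 5 != 0)%N.
  apply: contraTneq p_gt5 => p0; have : (5 %| p)%N by rewrite /dvdn p0.
  by rewrite dvdn_prime2 // => /eqP <-.
have psiNC : - (2 * psi t - 1) = 2 * psi (~~ t) - 1 by rewrite psiC; ring.
have : (p %% 5 < 5)%N by rewrite ltn_mod.
rewrite legendre5E; case: (p %% 5)%N psiE => [|[|[|[|[|]]]]] // -> _ _;
  rewrite ?mul1r ?mulN1r ?psiNC /psi; congr (2 * _ - 1); case: t {psiNC};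
  congr (- _); first [by [] | exact: addrC].
Qed.

(* [u t] is the image of [x] under the reduction sending [phi false] to [psi t].
   Both reductions are needed for the kernel to be generated by [p]: when [p]
   splits, a single one only detects one of the primes above [p]. *)
Definition reduces (x : algC) (u : bool -> F) : Prop :=
  exists a b D : int, [/\ D%:~R != 0 :> F, x * D%:~R = a%:~R + b%:~R * phi false
    & forall t, u t * D%:~R = a%:~R + b%:~R * psi t].

Lemma reduces_ext x u v : u =1 v -> reduces x u -> reduces x v.
Proof.
by move=> uv [a [b [D [D0 xE uE]]]]; exists a, b, D; split=> // t; rewrite -uv.
Qed.

Lemma reduces_int (n : int) : reduces n%:~R (fun=> n%:~R).
Proof.
exists n, 0, 1; split=> [||t]; rewrite ?oner_eq0 //.
  by rewrite mulr1 mul0r addr0.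
by rewrite mulr1 mul0r addr0.
Qed.

Lemma reduces_phi s : reduces (phi s) (fun t => psi (s (+) t)).
Proof.
case: s; last first.
  by exists 0, 1, 1; split=> [||t]; rewrite ?oner_eq0 // mulr1 mul1r add0r.
exists 1, (-1), 1; split=> [||t]; rewrite ?oner_eq0 //.
  by rewrite phi_true rmorphN1 mulr1 mulN1r.
by rewrite /= psiC rmorphN1 mulr1 mulN1r.
Qed.

Lemma reducesD x y u v : reduces x u -> reduces y v ->
  reduces (x + y) (fun t => u t + v t).
Proof.
case=> a [b [D [D0 xE uE]]] [a' [b' [D' [D'0 yE vE]]]].
exists (a * D' + a' * D), (b * D' + b' * D), (D * D'); split=> [||t].
- by rewrite rmorphM mulf_neq0.
- rewrite !(rmorphD, rmorphM) /=.
  transitivity (x * D%:~R * D'%:~R + y * D'%:~R * D%:~R); first by ring.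
  by rewrite xE yE; ring.
rewrite !(rmorphD, rmorphM) /=.
transitivity (u t * D%:~R * D'%:~R + v t * D'%:~R * D%:~R); first by ring.
by rewrite uE vE; ring.
Qed.

Lemma reducesM x y u v : reduces x u -> reduces y v ->
  reduces (x * y) (fun t => u t * v t).
Proof.
case=> a [b [D [D0 xE uE]]] [a' [b' [D' [D'0 yE vE]]]].
exists (a * a' + b * b'), (a * b' + a' * b + b * b'), (D * D'); split=> [||t].
- by rewrite rmorphM mulf_neq0.
- rewrite !(rmorphD, rmorphM) /=.
  transitivity ((x * D%:~R) * (y * D'%:~R)); first by ring.
  rewrite xE yE; transitivity (a%:~R * a'%:~R +
    (a%:~R * b'%:~R + a'%:~R * b%:~R) * phi false
    + b%:~R * b'%:~R * phi false ^+ 2).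
    by ring.
  by rewrite phi_sqr; ring.
rewrite !(rmorphD, rmorphM) /=.
transitivity ((u t * D%:~R) * (v t * D'%:~R)); first by ring.
rewrite uE vE; transitivity (a%:~R * a'%:~R +
  (a%:~R * b'%:~R + a'%:~R * b%:~R) * psi t + b%:~R * b'%:~R * psi t ^+ 2).
  by ring.
by rewrite psi_sqr; ring.
Qed.

Lemma reducesN x u : reduces x u -> reduces (- x) (fun t => - u t).
Proof.
move=> xu; rewrite -mulN1r -[-1]/((-1)%:~R).
apply: reduces_ext (reducesM (reduces_int (-1)) xu) => t.
by rewrite rmorphN1 mulN1r.
Qed.

Lemma reducesV n : n%:R != 0 :> F -> reduces n%:R^-1 (fun=> n%:R^-1).
Proof.
move=> n0; have nC : n%:R != 0 :> algC.
  by apply: contraNneq n0 => /eqP; rewrite pnatr_eq0 => /eqP ->.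
exists 1, 0, n; split=> // [|t].
  by rewrite mul0r addr0 mulVf.
by rewrite mul0r addr0 mulVf.
Qed.

Lemma reducesX x u n : reduces x u -> reduces (x ^+ n) (fun t => u t ^+ n).
Proof.
move=> xu; elim: n => [|n IHn]; first exact: reduces_int 1.
rewrite exprS; apply: reduces_ext (reducesM xu IHn) => t.
by rewrite exprS.
Qed.

Lemma reduces_sum (r : seq nat) (X : nat -> algC) (U : nat -> bool -> F) :
  (forall k, k \in r -> reduces (X k) (U k)) ->
  reduces (\sum_(k <- r) X k) (fun t => \sum_(k <- r) U k t).
Proof.
elim: r => [|k r IHr] XU.
  by rewrite big_nil; apply: reduces_ext (reduces_int 0) => t; rewrite big_nil.
rewrite big_cons; have XU' i : i \in r -> reduces (X i) (U i).
  by move=> ir; apply: XU; rewrite inE ir orbT.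
apply: reduces_ext (reducesD (XU k (mem_head _ _)) (IHr XU')) => t.
by rewrite big_cons.
Qed.

Lemma reduces_finpolylog d x u : reduces x u ->
  reduces (finpolylog p d x) (fun t => finpolylog p d (u t)).
Proof.
move=> xu; apply: reduces_sum => k; rewrite mem_index_iota => k_bd.
rewrite -natrX.
apply: reduces_ext (reducesM (reducesX k xu) (reducesV _)) => [t|].
  by rewrite natrX.
by rewrite natrX expf_neq0 // (natr_pchar_neq0 charFp).
Qed.

(** An expression a + b psi that vanishes at two distinct roots has a = b = 0 in F, so p divides
    both integers. Then x/p is an algebraic integer divided by [D], which is prime to p. *)
Lemma reduces0_integral_above x u : reduces x u -> (forall t, u t = 0) ->
  integral_above p (x / p%:R).
Proof.
case=> a [b [D [D0 xE uE]]] u0.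
have ab0 t : a%:~R + b%:~R * psi t = 0 by rewrite -uE u0 mul0r.
have b0 : b%:~R = 0 :> F.
  have : b%:~R * (psi false - psi true) = 0.
    transitivity (a%:~R + b%:~R * psi false - (a%:~R + b%:~R * psi true)).
      by ring.
    by rewrite !ab0 subrr.
  by move/eqP; rewrite mulf_eq0 subr_eq0 (negPf psi_neq) orbF => /eqP.
have a0 : a%:~R = 0 :> F by have := ab0 false; rewrite b0 mul0r addr0.
have /dvdzP[a' aE] : (p %| a)%Z by rewrite (dvdz_pcharf charFp) a0.
have /dvdzP[b' bE] : (p %| b)%Z by rewrite (dvdz_pcharf charFp) b0.
have p0 : p%:R != 0 :> algC by rewrite pnatr_eq0 -lt0n prime_gt0.
have DC : D%:~R != 0 :> algC.
  by apply: contraNneq D0 => /eqP; rewrite intr_eq0 => /eqP ->.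
pose w : algC := a'%:~R + b'%:~R * phi false.
have wO : w \in OQsqrt5_pred.
  apply: rpredD; first exact: rpred_int.
  by apply: rpredM; [exact: rpred_int | exact: phi_OQsqrt5].
have xw : x / p%:R = w / D%:~R.
  apply: (mulIf DC); rewrite divfK // mulrAC xE aE bE !rmorphM /=.
  by rewrite /w -!pmulrn; field.
have wQ : w \in Qsqrt5 by case/andP: wO.
split.
  have /Qsqrt5P[c [d wE]] := wQ; apply/Qsqrt5P; exists (c / D%:~R), (d / D%:~R).
  by rewrite xw wE !rmorphM !fmorphV !rmorph_int; field.
move=> P pP; exists (Sub w wO), D%:~R; split; last first.
  by rewrite xw SubK rmorph_int.
(* If [D] were in [P] along with p, a Bezout relation would put 1 in [P]. *)
apply/negP => DP; have /negP[] : 1 \notin P by rewrite idealr1.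
have cop : coprimez D p.
  rewrite coprimezE coprime_sym prime_coprime //.
  by apply: contra D0; rewrite -(dvdz_pcharf charFp) dvdzE.
have [m [n mn]] := Bezoutz D p.
have -> : 1 = m%:~R * D%:~R + n%:~R * p%:R :> OQsqrt5.
  by rewrite pmulrn -!rmorphM -rmorphD mn (eqP cop).
by rewrite rpredD // idealMr.
Qed.

Lemma reduces_congr x y u v : reduces x u -> reduces y v -> u =1 v ->
  congr_mod p x y.
Proof.
move=> xu yv uv.
apply: reduces0_integral_above (reducesD xu (reducesN yv)) _ => t.
by rewrite uv subrr.
Qed.

(** * The Lucas quotient modulo p *)

Lemma binomial_pred_pchar j : (j < p)%N -> 'C(p.-1, j)%:R = (-1) ^+ j :> F.
Proof.
elim: j => [|j IHj] jp; first by rewrite bin0 expr0.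
have := bin_lt_pcharf_0 charFp (k := j.+1); rewrite jp => /(_ isT).
rewrite -[in 'C(p, _)](prednK (prime_gt0 p_prime)) binS natrD.
rewrite IHj; last exact: ltnW.
by rewrite exprS => /eqP; rewrite addr_eq0 mulN1r => /eqP.
Qed.

(** Expand (1 - phi)^p in L_p = phi^p + (1 - phi)^p: for odd p the top term cancels phi^p, the
    constant term cancels the 1 subtracted in q_L, and p divides every other binomial
    coefficient. *)
Lemma lucas_quotientE s : ratr (lucas_quotient p) =
  \sum_(1 <= k < p) (- phi s) ^+ k * ('C(p, k) %/ p)%:R :> algC.
Proof.
have p_gt0 := prime_gt0 p_prime.
have p0 : p%:R != 0 :> algC by rewrite pnatr_eq0 -lt0n.
have p_odd : odd p by case: (even_prime p_prime) => // p2; lia.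
rewrite /lucas_quotient rmorphM fmorphV rmorphB rmorph1 !rmorph_nat /=.
apply: (mulIf p0); rewrite divfK // (lucas_phi s) [1 - _]addrC exprD1n.
rewrite big_ord_recr /= binn exprNn -signr_odd p_odd expr1 mulN1r mulr1n.
rewrite -(big_mkord xpredT (fun k => (- phi s) ^+ k *+ 'C(p, k))) big_ltn //.
rewrite expr0 bin0 mulr1n mulr_suml.
rewrite [X in X - 1 = _](_ : _ =
    1 + \sum_(1 <= k < p) (- phi s) ^+ k *+ 'C(p, k)).
  rewrite [1 + _]addrC addrK; apply: eq_big_nat => k k_bd.
  by rewrite -mulrA -natrM divnK ?prime_dvd_bin // mulr_natr.
by rewrite addrCA subrr addr0.
Qed.

(** From k C(p,k)/p = C(p-1,k-1), which is (-1)^(k-1) in F, the k-th term of [lucas_quotientE]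
    reduces to -psi^k/k. *)
Lemma reduces_lucas_quotient s :
  reduces (ratr (lucas_quotient p)) (fun t => - finpolylog p 1 (psi (s (+) t))).
Proof.
rewrite (lucas_quotientE s).
apply: reduces_ext (reduces_sum (U := fun k t =>
   (- psi (s (+) t)) ^+ k * ('C(p, k) %/ p)%:R) _) => [t|k _]; last first.
  apply: reducesM (reducesX k (reducesN (reduces_phi s))) _.
  by rewrite pmulrn; apply: reduces_ext (reduces_int _) => t; rewrite pmulrn.
rewrite /finpolylog -sumrN; apply: eq_big_nat => k k_bd.
have k0 := natr_pchar_neq0 charFp k_bd.
have p_gt0 := prime_gt0 p_prime; have [k_gt0 k_lt] := andP k_bd.
have cE : k%:R * ('C(p, k) %/ p)%:R = - (-1) ^+ k :> F.
  have -> : - (-1) ^+ k = 'C(p.-1, k.-1)%:R :> F.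
    rewrite binomial_pred_pchar; last by lia.
    by rewrite -{1}(prednK k_gt0) exprS mulN1r opprK.
  rewrite -natrM; congr (_%:R); apply/eqP; rewrite -(eqn_pmul2l p_gt0).
  rewrite mul_bin_diag prednK // mulnCA [(p * _)%N]mulnC.
  by rewrite divnK // prime_dvd_bin.
apply: (mulfI k0); rewrite mulrCA cE [(- psi _) ^+ k]exprNn expr1.
have: (-1) ^+ k * (-1) ^+ k = 1 :> F by rewrite -expr2 sqrr_sign.
move: ((-1) ^+ k) (psi _ ^+ k) => g w gg.
transitivity (- (g * g * w)); first by ring.
by rewrite gg mul1r [RHS]mulrN mulrC divfK.
Qed.

Lemma reduces_bernoulli n : (n < p.-1)%N ->
  reduces (ratr (bernoulli n)) (fun=> bernoulli_mod n).
Proof.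
move=> np; have f0 : (n.+1)`!%:R != 0 :> F by apply: natr_fact_neq0; lia.
exists (numq ((n.+1)`!%:R * bernoulli n)), 0, (n.+1)`!; split=> // [|t].
  rewrite mul0r addr0 -[LHS]/(_ * (n.+1)`!%:R) -(ratr_nat _ (n.+1)`!).
  by rewrite -rmorphM /= mulrC -{1}(numqK (bernoulli_fact_int n)) ratr_int.
by rewrite mul0r addr0 -bernoulli_modE.
Qed.

Lemma golden_ratio_congruences (s : bool) :
  let pm : algC := (-1) ^+ s in
  let leg : algC := (legendre p 5)%:~R in
  let qL : algC := ratr (lucas_quotient p) in
  [/\ congr_mod p (finpolylog p 2 (phi s))
        (- pm * (sqrt5 / 10) * leg * qL ^+ 2),
      congr_mod p (finpolylog p 2 (phi s ^+ 2))
        (- (1 / 2) * (1 + pm * (sqrt5 / 5) * leg) * qL ^+ 2),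
      congr_mod p (finpolylog p 2 (- phi s))
        (- (1 / 4) * (1 + pm * (sqrt5 / 5) * leg) * qL ^+ 2)
    & congr_mod p (finpolylog p 3 (phi s ^+ 2))
        (- (2 / 15) * (1 + pm * sqrt5 * leg) *
         (1 / 2 * qL ^+ 3 + ratr (bernoulli (p - 3))))].
Proof.
move=> pm leg qL.
have red_nat n : reduces n%:R (fun=> n%:R).
  by rewrite 2!pmulrn; exact: reduces_int.
have nat0 n : (0 < n < 6)%N -> n%:R != 0 :> F.
  by move=> n_bd; rewrite (natr_pchar_neq0 charFp) //; lia.
have [two0 three0 five0] := And3 (nat0 2 isT) (nat0 3 isT) (nat0 5 isT).
have red2 := reducesV two0.
have red4 := reducesV (nat0 4 isT).
have red5 := reducesV five0.
have red10 : reduces 10^-1 (fun=> 10^-1).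
  by apply: reducesV; rewrite (natrM _ 2 5) mulf_neq0.
have red15 : reduces 15^-1 (fun=> 15^-1).
  by apply: reducesV; rewrite (natrM _ 3 5) mulf_neq0.
have redphi := reduces_phi s.
have redr : reduces (pm * sqrt5 * leg)
    (fun t => (2 * psi (s (+) t) - 1) * (legendre p 5)%:~R).
  rewrite sqrt5_phi; apply: reducesM; last exact: reduces_int.
  by apply: reducesD (reducesM (red_nat 2) redphi) (reducesN (red_nat 1)).
have redq : reduces qL _ := reduces_lucas_quotient s.
have redb : reduces (ratr (bernoulli (p - 3))) (fun=> bernoulli_mod (p - 3)).
  by apply: reduces_bernoulli; lia.
have golden t := golden_ratio_finpolylog charFp p_gt5
  (psi_sqr (s (+) t)) bernoulli_mod_rec.
(* This identifies the [r] of [golden_ratio_finpolylog] with the reduction of [pm * sqrt5 * leg]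
   given by [redr]. *)
have legE t : 2 * psi (s (+) t) ^+ p - 1 =
    (2 * psi (s (+) t) - 1) * (legendre p 5)%:~R.
  by rewrite psi_frobenius mulrC.
have red1 := red_nat 1.
split.
- have -> : - pm * (sqrt5 / 10) * leg * qL ^+ 2 =
      - (pm * sqrt5 * leg * 10^-1) * qL ^+ 2.
    by rewrite !mulNr; congr (- (_ * _)); ring.
  apply: reduces_congr (reduces_finpolylog 2 redphi)
    (reducesM (reducesN (reducesM redr red10)) (reducesX 2 redq)) _ => t.
  by have [-> _ _ _] := golden t; rewrite legE.
- have -> : pm * (sqrt5 / 5) * leg = pm * sqrt5 * leg * 5^-1 by ring.
  apply: reduces_congr (reduces_finpolylog 2 (reducesX 2 redphi))
    (reducesM (reducesM (reducesN (reducesM red1 red2))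
      (reducesD red1 (reducesM redr red5))) (reducesX 2 redq)) _ => t.
  by have [_ -> _ _] := golden t; rewrite legE.
- have -> : pm * (sqrt5 / 5) * leg = pm * sqrt5 * leg * 5^-1 by ring.
  apply: reduces_congr (reduces_finpolylog 2 (reducesN redphi))
    (reducesM (reducesM (reducesN (reducesM red1 red4))
      (reducesD red1 (reducesM redr red5))) (reducesX 2 redq)) _ => t.
  by have [_ _ -> _] := golden t; rewrite legE.
apply: reduces_congr (reduces_finpolylog 3 (reducesX 2 redphi))
  (reducesM (reducesM (reducesN (reducesM (red_nat 2) red15))
    (reducesD red1 redr))
    (reducesD (reducesM (reducesM red1 red2) (reducesX 3 redq)) redb)) _ => t.
by have [_ _ _ ->] := golden t; rewrite legE.
Qed.

End Reduction.

Theorem theorem4p4 (p : nat) (p_prime : prime p) (p_gt5 : (5 < p)%N) (s : bool) :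
  let pm : algC := (-1) ^+ s in
  let leg : algC := (legendre p 5)%:~R in
  let qL : algC := ratr (lucas_quotient p) in
  [/\ congr_mod p (finpolylog p 2 (phi s))
        (- pm * (sqrt5 / 10) * leg * qL ^+ 2),
      congr_mod p (finpolylog p 2 (phi s ^+ 2))
        (- (1 / 2) * (1 + pm * (sqrt5 / 5) * leg) * qL ^+ 2),
      congr_mod p (finpolylog p 2 (- phi s))
        (- (1 / 4) * (1 + pm * (sqrt5 / 5) * leg) * qL ^+ 2)
    & congr_mod p (finpolylog p 3 (phi s ^+ 2))
        (- (2 / 15) * (1 + pm * sqrt5 * leg) *
         (1 / 2 * qL ^+ 3 + ratr (bernoulli (p - 3))))].
Proof.
have [K [incl _]] := countable_algebraic_closure 'F_p.
(* An algebraic closure of the prime field provides the required root of 1 + X + X^2 + X^3 + X^4,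
   whatever p is modulo 5. *)
have charKp : p \in [pchar K] by rewrite (fmorph_pchar incl) pchar_Fp.
have [z /rootP z_root] : exists z : K, root (\poly_(i < 5) 1) z.
  apply/closed_rootP; rewrite size_poly_eq ?oner_eq0 //.
apply: (golden_ratio_congruences charKp p_gt5 (z := z)).
by rewrite -z_root horner_poly !big_ord_recr big_ord0 /= !mul1r add0r.
Qed.
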